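(* Let $T\subset[0,\infty)$ be locally finite. Then the following are equivalent: (i) $T\in\mathfrak U$; (ii) for every separable complex Hilbert space $H$, every positive $A\in\mathcal B(H)$, and every finite or countable indexed family $\mathcal F=(f_i)_{i\in I}$ in $H$: if $\mathcal O_{\mathbb N}(A,\mathcal F)$ is a frame for $H$, then $\mathcal O_T(A,\mathcal F)$ is a frame for $H$.
   Context: $\mathbb N=\{0,1,2,\dots\}$. A set $T\subset[0,\infty)$ is locally finite if $T\cap[0,R]$ is finite for every $R>0$. For a positive operator $A$ on a Hilbert space, $A^t$ is defined by continuous functional calculus for $t>0$ and $A^0=I$. For a time set $T$ and an indexed family $\mathcal F=(f_i)_{i\in I}$ in $H$, $\mathcal O_T(A,\mathcal F)=\{A^tf_i:t\in T,\ i\in I\}$, regarded as a family indexed by $T\times I$; it is a frame for $H$ if there are $0<a\le b<\infty$ with $a\|x\|^2\le\sum_{t\in T}\sum_{i\in I}|\langle x,A^tf_i\rangle|^2\le b\|x\|^2$ for all $x\in H$. The family $\{CA^t\}_{t\in T}$ is exactly observable if there are $0<a\le b<\infty$ with $a\|x\|^2\le\sum_{t\in T}\|CA^tx\|^2\le b\|x\|^2$ for all $x\in H$. $\mathfrak U$ is the class of universal time sets: locally finite $T\subset[0,\infty)$ such that for all separable complex Hilbert spaces $H,Y$, every positive $A\in\mathcal B(H)$ and every $C\in\mathcal B(H,Y)$, exact observability of $\{CA^n\}_{n\in\mathbb N}$ implies exact observability of $\{CA^t\}_{t\in T}$. *)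

(* Defs.v *)
From HB Require Import structures.
From mathcomp Require Import all_boot all_order all_algebra.
From mathcomp Require Import all_classical all_reals all_analysis.
From mathcomp Require Import complex.

Set Implicit Arguments.
Unset Strict Implicit.
Unset Printing Implicit Defensive.

Import Order.TTheory GRing.Theory Num.Theory Num.Def.
Import numFieldNormedType.Exports.

Local Open Scope classical_set_scope.
Local Open Scope ring_scope.
Local Open Scope complex_scope.

(* The inner product is linear in its first argument and conjugate-linear in
   the second. *)
Record hilbertSpace (R : realType) := HilbertSpace {
  hilbert_sort :> completeNormedModType R[i];
  inner : {dot hilbert_sort for conjC};
  inner_norm : forall x : hilbert_sort, inner x x = `|x| ^+ 2 }.

Notation "''<' x , y '>'" := (inner _ x y)
  (at level 2, x at level 69, y at level 69, format "''<' x ,  y '>'") :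
  ring_scope.

Definition separable_space (X : topologicalType) :=
  exists S : set X, countable S /\ dense S.

(* Norms over R[i] take values in R[i]; this is the real number |x|^2. *)
Definition sqnorm (R : realType) (V : normedZmodType R[i]) (x : V) : R :=
  complex.Re `|x| ^+ 2.

Section operators.
Variables (R : realType) (H : hilbertSpace R).
Implicit Types A B : {linear H -> H}.

(* For the partial order of R[i], 0 <= z says that z is real and nonnegative. *)
Definition positive_op A := continuous A /\ forall x : H, 0 <= '<A x, x>.

Definition spectrum A : set R[i]^o :=
  [set z | ~ exists B, continuous B /\
     forall x : H, B (z *: x - A x) = x /\ z *: B x - A (B x) = x].

Definition cont_spectrum A (f : R[i] -> R[i]) :=
  {within spectrum A, continuous (f : R[i]^o -> R[i]^o)}.

(* [is_cfc A Phi]: Phi is the continuous functional calculus of A, i.e. the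
   contractive unital *-homomorphism from C(spectrum A) to B(H) that maps the
   coordinate function to A. Elements of C(spectrum A) are represented by
   functions on R[i], up to equality on the spectrum; values of Phi at functions
   that are not continuous on the spectrum are irrelevant. By Stone-Weierstrass
   Phi is unique on C(spectrum A), and it exists for every self-adjoint A. *)
Record is_cfc A (Phi : (R[i] -> R[i]) -> {linear H -> H}) : Prop := IsCfc {
  cfc_continuous : forall f, cont_spectrum A f -> continuous (Phi f);
  cfc_ext : forall f g, cont_spectrum A f -> cont_spectrum A g ->
    (forall z, spectrum A z -> f z = g z) -> Phi f =1 Phi g;
  cfc_one : Phi (fun=> 1) =1 id;
  cfc_id : Phi id =1 A;
  cfc_add : forall f g, cont_spectrum A f -> cont_spectrum A g ->
    forall x, Phi (fun z => f z + g z) x = Phi f x + Phi g x;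
  cfc_scale : forall (c : R[i]) f, cont_spectrum A f ->
    forall x, Phi (fun z => c * f z) x = c *: Phi f x;
  cfc_mul : forall f g, cont_spectrum A f -> cont_spectrum A g ->
    forall x, Phi (fun z => f z * g z) x = Phi f (Phi g x);
  cfc_adjoint : forall f, cont_spectrum A f ->
    forall x y : H, '<Phi f x, y> = '<x, Phi (fun z => conjC (f z)) y>;
  cfc_contractive : forall f (M : R[i]), cont_spectrum A f ->
    (forall z, spectrum A z -> `|f z| <= M) ->
    forall x, `|Phi f x| <= M * `|x| }.

(* The value 0 is used only when A has no continuous functional calculus. *)
Definition cfc A : (R[i] -> R[i]) -> {linear H -> H} :=
  if pselect (exists Phi, is_cfc A Phi) is left e then sval (cid e)
  else fun=> \0.

(* A^t; for positive A the spectrum lies in [0, +oo), where the function below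
   is x |-> x^t; the maximum makes it continuous on all of R[i] for t > 0. *)
Definition opow A (t : R) : {linear H -> H} :=
  if t == 0 then (idfun : {linear H -> H})
  else cfc A (fun z => (Num.max (complex.Re z) 0 `^ t)%:C).

(* The family A^t f_i, t in T, i in I, is a frame for H. *)
Definition orbit_frame (T : set R) A (I : countType) (f : I -> H) :=
  exists a b : R, [/\ 0 < a, a <= b & forall x : H,
    ((a * sqnorm x)%:E <=
       \esum_(t in T) \esum_(i in [set: I]) (sqnorm '<x, opow A t (f i)>)%:E <=
     (b * sqnorm x)%:E)%E].

Definition exactly_observable (Y : hilbertSpace R) (T : set R) A
    (C : {linear H -> Y}) :=
  exists a b : R, [/\ 0 < a, a <= b & forall x : H,
    ((a * sqnorm x)%:E <= \esum_(t in T) (sqnorm (C (opow A t x)))%:E <=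
     (b * sqnorm x)%:E)%E].

End operators.

Section time_sets.
Variable R : realType.

Definition Ntimes : set R := range (fun n : nat => n%:R).

Definition locally_finite_times (T : set R) :=
  (forall t, T t -> 0 <= t) /\
  forall r : R, 0 < r -> finite_set (T `&` [set` `[0, r]]).

Definition universal_times (T : set R) :=
  locally_finite_times T /\
  forall H Y : hilbertSpace R, separable_space H -> separable_space Y ->
  forall (A : {linear H -> H}) (C : {linear H -> Y}),
    positive_op A -> continuous C ->
    exactly_observable Ntimes A C -> exactly_observable T A C.

End time_sets.

(* Main.v *)
Require Import Defs.
From HB Require Import structures.
From mathcomp Require Import all_boot all_order all_algebra.
From mathcomp Require Import all_classical all_reals all_analysis.
From mathcomp Require Import complex ring.

(* Both properties of T only involve a family or an operator through the
   quadratic form sum_i |<x, f_i>|^2, respectively |C x|^2, evaluated at the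
   vectors A^t x, because A^t is self-adjoint. So it suffices to realise every
   form of one kind as a form of the other kind. Given C : H -> Y, take
   f_i = C^* e_i for an orthonormal basis (e_i) of Y. Conversely, a frame orbit
   at time 0 shows that (f_i) is a Bessel sequence, so that
   q(x, y) = sum_i <x, f_i><f_i, y> is a bounded positive semidefinite form.
   Applying Gram-Schmidt to one dense sequence of H, for q and for the inner
   product, gives q-orthonormal vectors u_n and orthonormal vectors e_n; then
   C x = sum_n q(x, u_n) e_n satisfies |C x|^2 = q(x, x), and Y = H suffices.
   Both families may contain zero vectors, but e_n = 0 forces u_n = 0. *)

Set Implicit Arguments.
Unset Strict Implicit.
Unset Printing Implicit Defensive.

Import Order.TTheory GRing.Theory Num.Theory.
Import numFieldNormedType.Exports.

Local Open Scope classical_set_scope.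
Local Open Scope ring_scope.

(** * Gram-Schmidt for a positive semidefinite form *)

(** Degenerate forms have to be covered: a single vector f may generate a frame orbit, while |<x,
    f>|^2 vanishes on a hyperplane. *)
Record psd_form (C : numClosedFieldType) (V : lmodType C) (q : V -> V -> C)
  : Prop := PsdForm {
  psd_linear : forall a x y z, q (a *: x + y) z = a * q x z + q y z;
  psd_conj : forall x y, q y x = (q x y)^*;
  psd_ge0 : forall x, 0 <= q x x }.

Section gram_schmidt.
Variables (C : numClosedFieldType) (V : lmodType C) (q : V -> V -> C).
Hypothesis qP : psd_form q.

Lemma psd_addl x y z : q (x + y) z = q x z + q y z.
Proof. by rewrite -[x]scale1r (psd_linear qP) mul1r scale1r. Qed.

Lemma psd_0l z : q 0 z = 0.
Proof. by apply: (addrI (q 0 z)); rewrite -psd_addl !addr0. Qed.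

Lemma psd_scalel a x z : q (a *: x) z = a * q x z.
Proof. by rewrite -[a *: x]addr0 (psd_linear qP) psd_0l addr0. Qed.

Lemma psd_subl x y z : q (x - y) z = q x z - q y z.
Proof. by rewrite psd_addl -scaleN1r psd_scalel mulN1r. Qed.

Lemma psd_addr x y z : q z (x + y) = q z x + q z y.
Proof. by rewrite ![q z _](psd_conj qP) psd_addl rmorphD. Qed.

Lemma psd_scaler a x z : q z (a *: x) = a^* * q z x.
Proof. by rewrite ![q z _](psd_conj qP) psd_scalel rmorphM. Qed.

Lemma psd_subr x y z : q z (x - y) = q z x - q z y.
Proof. by rewrite ![q z _](psd_conj qP) psd_subl rmorphB. Qed.

Lemma psd_suml (I : Type) (r : seq I) (F : I -> V) z :
  q (\sum_(i <- r) F i) z = \sum_(i <- r) q (F i) z.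
Proof.
exact: (big_morph (fun x => q x z) (fun x y => psd_addl x y z) (psd_0l z)).
Qed.

Lemma psd_norm_conj x y : q x y * q y x = `|q x y| ^+ 2.
Proof. by rewrite normCK (psd_conj qP x y). Qed.

(** Expand q(z, z) >= 0 at z = x - t q(x, y) y with t real. The optimal choice is t = 1 / q(y, y); a
    null y is treated separately. *)
Lemma psd_CauchySchwarz x y : `|q x y| ^+ 2 <= q x x * q y y.
Proof.
have key t : t \is Num.real ->
    0 <= q x x - (t * `|q x y| ^+ 2) *+ 2 + t ^+ 2 * `|q x y| ^+ 2 * q y y.
  move=> tR; have := psd_ge0 qP (x - (t * q x y) *: y).
  rewrite psd_subl !psd_subr !psd_scalel !psd_scaler rmorphM /= (CrealP tR).
  rewrite -(psd_conj qP).
  rewrite -psd_norm_conj; congr (_ <= _); ring.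
have [n0|n0] := eqVneq (q x y) 0.
  by rewrite n0 normr0 expr0n mulr_ge0 ?(psd_ge0 qP).
have n1 : 0 < `|q x y| ^+ 2 by rewrite exprn_gt0 ?normr_gt0.
have := psd_ge0 qP y; rewrite le_eqVlt => /predU1P[d0|d0].
  (* When q(y, y) = 0 the bound is affine in t, and this t gives it the value -1. *)
  have := key ((q x x + 1) / (`|q x y| ^+ 2 *+ 2)).
  rewrite -d0 !mulr0 addr0 => /(_ _)/wrap[|].
    apply: realM; first by rewrite ger0_real // addr_ge0 ?(psd_ge0 qP).
    by rewrite realV ger0_real // mulrn_wge0 // ltW.
  suff -> : q x x - ((q x x + 1) / (`|q x y| ^+ 2 *+ 2) * `|q x y| ^+ 2) *+ 2
       = -1 by rewrite oppr_ge0 lt_geF ?ltr01.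
  have /lt0r_neq0 := n1; move: (_ ^+ 2) (q x x) => n a n2.
  by field.
have := key (q y y)^-1; rewrite realV (ger0_real (ltW d0)) => /(_ isT).
have -> : q x x - ((q y y)^-1 * `|q x y| ^+ 2) *+ 2
   + (q y y)^-1 ^+ 2 * `|q x y| ^+ 2 * q y y = q x x - `|q x y| ^+ 2 / q y y.
  have /lt0r_neq0 := d0; move: (_ ^+ 2) (q y y) => n a n2.
  by field.
by rewrite subr_ge0 ler_pdivrMr.
Qed.

Lemma psd_null_r x y : q y y = 0 -> q x y = 0.
Proof.
move=> y0; have := psd_CauchySchwarz x y.
rewrite y0 mulr0 => h; apply/eqP; rewrite -normr_eq0 -sqrf_eq0.
by rewrite eq_le h exprn_ge0.
Qed.

Lemma psd_null_l x y : q y y = 0 -> q y x = 0.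
Proof.
by move=> /(psd_null_r x); rewrite (psd_conj qP x y) => ->; rewrite conjC0.
Qed.

Lemma psd_null_addr x y : q y y = 0 -> q (x + y) (x + y) = q x x.
Proof.
move=> y0; rewrite psd_addl !psd_addr y0 (psd_null_l x y0) (psd_null_r x y0).
by rewrite !addr0.
Qed.

Variable s : nat -> V.

(* Dividing by 0 gives 0, so null vectors are mapped to 0. *)
Definition psd_normalize (x : V) : V := (sqrtC (q x x))^-1 *: x.

Lemma psd_normalizeE x :
  q (psd_normalize x) (psd_normalize x) = (q x x != 0)%:R.
Proof.
rewrite psd_scalel psd_scaler mulrA -normCK normfV exprVn.
rewrite ger0_norm ?sqrtC_ge0 ?(psd_ge0 qP) // sqrtCK.
by case: eqVneq => [->|x0]; rewrite ?mulr0 // mulVf.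
Qed.

Definition residual_seq (l : seq V) (x : V) : V :=
  x - \sum_(v <- l) q x v *: v.

(** Each new vector depends on all earlier ones, so the recursion builds the whole list. [residual]
    recovers the usual indexed sums. *)
Fixpoint gram_schmidt_seq (n : nat) : seq V :=
  if n is m.+1 then
    rcons (gram_schmidt_seq m)
      (psd_normalize (residual_seq (gram_schmidt_seq m) (s m)))
  else [::].

Definition gram_schmidt (n : nat) : V :=
  psd_normalize (residual_seq (gram_schmidt_seq n) (s n)).

Local Notation u := gram_schmidt.

Definition residual (n : nat) (x : V) : V := x - \sum_(i < n) q x (u i) *: u i.

Lemma residual_seqE n x :
  residual_seq (gram_schmidt_seq n) x = residual n x.
Proof.
rewrite /residual_seq /residual; congr (_ - _).
elim: n => [|n IHn]; first by rewrite big_nil big_ord0.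
by rewrite /= big_rcons /= IHn big_ord_recr.
Qed.

Lemma gram_schmidtE n : u n = psd_normalize (residual n (s n)).
Proof. by rewrite -residual_seqE. Qed.

Lemma residual0 x : residual 0 x = x.
Proof. by rewrite /residual big_ord0 subr0. Qed.

Lemma residualS n x : residual n.+1 x = residual n x - q x (u n) *: u n.
Proof. by rewrite /residual big_ord_recr /= opprD addrA. Qed.

Lemma gram_schmidt_norm n : q (u n) (u n) = (q (u n) (u n) != 0)%:R.
Proof. by rewrite gram_schmidtE psd_normalizeE pnatr_eq0 eqb0 negbK. Qed.

(** Replaces q(u_n, u_n) = 1, which fails for a null u_n; by Cauchy-Schwarz such a u_n is orthogonal
    to every x. *)
Lemma psd_gram_schmidt x n : q x (u n) * q (u n) (u n) = q x (u n).
Proof.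
rewrite gram_schmidt_norm; case: eqVneq => [u0|]; last by rewrite mulr1.
by rewrite (psd_null_r x u0) mul0r.
Qed.

Lemma gram_schmidt_orthogonal i j : i != j -> q (u i) (u j) = 0.
Proof.
suff h n : forall i j, (i < j)%N -> (j < n)%N -> q (u j) (u i) = 0.
  case: (ltngtP i j) => // ij _; last exact: (h i.+1).
  by rewrite (psd_conj qP (u j)) (h j.+1) // conjC0.
elim: n => // n IHn {}i {}j ij; rewrite ltnS leq_eqVlt => /predU1P[jn|]; last exact: IHn.
subst j; rewrite [u n]gram_schmidtE psd_scalel.
apply/eqP; rewrite mulf_eq0 orbC; apply/orP; left; apply/eqP.
(* By induction only the term of index i survives in the projection, and it cancels q(s_n, u_i). *)
rewrite psd_subl psd_suml (bigD1 (Ordinal ij)) //=.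
rewrite psd_scalel psd_gram_schmidt big1 ?addr0 ?subrr // => k /eqP ki.
rewrite psd_scalel.
have {}ki : (k : nat) <> i by move=> h; apply: ki; apply: val_inj.
case: (ltngtP k i) => // h.
  by rewrite (psd_conj qP (u i)) (IHn k i) ?conjC0 ?mulr0.
by rewrite IHn ?mulr0.
Qed.

Lemma psd_residual_ge x n i : (n <= i)%N -> q (residual n x) (u i) = q x (u i).
Proof.
move=> ni; rewrite psd_subl psd_suml big1 ?subr0 // => k _.
by rewrite psd_scalel gram_schmidt_orthogonal ?mulr0 // neq_ltn (leq_trans (ltn_ord k)).
Qed.

(** Pythagoras, one vector at a time; a null u_n subtracts nothing. *)
Lemma residual_norm x n :
  q (residual n x) (residual n x) = q x x - \sum_(i < n) `|q x (u i)| ^+ 2.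
Proof.
elim: n => [|n IHn]; first by rewrite residual0 big_ord0 subr0.
rewrite residualS big_ord_recr /= opprD addrA -IHn.
have rv : q (residual n x) (u n) = q x (u n) by rewrite psd_residual_ge.
have vr : q (u n) (residual n x) = (q x (u n))^*%R.
  by rewrite (psd_conj qP (residual n x)) rv.
have := psd_gram_schmidt x n; move: (residual n x) (u n) rv vr => r v rv vr vv.
rewrite psd_subl !psd_subr !psd_scalel !psd_scaler vr rv mulrCA vv normCK.
by ring.
Qed.

Lemma bessel x n : \sum_(i < n) `|q x (u i)| ^+ 2 <= q x x.
Proof. by rewrite -subr_ge0 -residual_norm (psd_ge0 qP). Qed.

Lemma residual_antitone x m n : (m <= n)%N ->
  q (residual n x) (residual n x) <= q (residual m x) (residual m x).
Proof.
elim: n => [|n IHn]; first by rewrite leqn0 => /eqP ->.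
rewrite leq_eqVlt => /predU1P[->//|/IHn]; apply: le_trans.
rewrite !residual_norm big_ord_recr /= opprD addrA lerBlDr lerDl.
by rewrite exprn_ge0.
Qed.

Lemma residual_linear n a x y :
  residual n (a *: x + y) = a *: residual n x + residual n y.
Proof.
rewrite /residual scalerBr addrACA -opprD; congr (_ - _).
rewrite scaler_sumr -big_split /=; apply: eq_bigr => i _.
by rewrite (psd_linear qP) scalerDl -scalerA.
Qed.

(** With r the residual of s_m at stage m, u_m is r divided by its q-norm, so |q(s_m, u_m)|^2 = q(r,
    r) and stage m + 1 removes everything. Later stages cannot increase the residual. *)
Lemma residual_null n m : (m < n)%N -> q (residual n (s m)) (residual n (s m)) = 0.
Proof.
move=> mn; apply/eqP; rewrite eq_le (psd_ge0 qP) andbT.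
apply: le_trans (residual_antitone _ mn) _.
set r := residual m (s m); rewrite residual_norm big_ord_recr /= opprD addrA.
rewrite -residual_norm -(psd_residual_ge (s m) (leqnn m)) gram_schmidtE psd_scaler -/r.
rewrite normrM norm_conjC normfV exprMn exprVn.
rewrite [`|sqrtC _|]ger0_norm ?sqrtC_ge0 ?(psd_ge0 qP) // sqrtCK.
rewrite ger0_norm ?(psd_ge0 qP) // expr2 mulrA.
have [->|r0] := eqVneq (q r r) 0; first by rewrite mulr0 subrr.
by rewrite mulVf // mul1r subrr.
Qed.

(** Best approximation: x and x - s_m have the same residual up to a null vector, and taking
    residuals does not increase q. This is how density of s enters. *)
Lemma residual_le x n m : (m < n)%N ->
  q (residual n x) (residual n x) <= q (x - s m) (x - s m).
Proof.
move=> mn; have -> : residual n x = residual n (x - s m) + residual n (s m).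
  have := residual_linear n 1 (x - s m) (s m).
  by rewrite !scale1r subrK.
rewrite psd_null_addr ?residual_null // residual_norm lerBlDr lerDl.
by apply: sumr_ge0 => i _; rewrite exprn_ge0.
Qed.

End gram_schmidt.

(* If s n lies in the span of s 0, ..., s (n - 1), it does so for every form. *)
Lemma gram_schmidt_eq0 (C : numClosedFieldType) (V : lmodType C)
    (p q : V -> V -> C) (s : nat -> V) (n : nat) :
  psd_form p -> psd_form q -> (forall x, p x x = 0 -> x = 0) ->
  gram_schmidt p s n = 0 -> gram_schmidt q s n = 0.
Proof.
move=> pP qP pdef en0.
(* W is the subspace of vectors lying, up to null vectors of q, in the span of the first n vectors
   made for q. It contains s_0, ..., s_(n-1), hence also the first n vectors made for p. *)
pose W x := q (residual q s n x) (residual q s n x) = 0.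
have W0 : W 0.
  rewrite /W [residual q s n 0](_ : _ = 0) ?(psd_0l qP) //.
  by rewrite /residual big1 ?subr0 // => i _; rewrite (psd_0l qP) scale0r.
have WD a x y : W x -> W y -> W (a *: x + y).
  move=> Wx Wy; rewrite /W (residual_linear qP) (psd_null_addr qP _ Wy).
  by rewrite (psd_scalel qP) (psd_scaler qP) Wx !mulr0.
have Wsum m : (forall i, (i < m)%N -> W (gram_schmidt p s i)) ->
    forall c, W (\sum_(i < m) c i *: gram_schmidt p s i).
  move=> h c; elim: m h c => [|m IHm] h c; first by rewrite big_ord0.
  rewrite big_ord_recr /= addrC; apply: WD; first exact: h.
  by apply: IHm => i im; apply: h; rewrite ltnS ltnW.
have We m : (m <= n)%N -> forall i, (i < m)%N -> W (gram_schmidt p s i).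
  elim: m => // m IHm mn i; rewrite ltnS leq_eqVlt => /predU1P[->|im]; last first.
    by apply: IHm => //; exact: ltnW.
  rewrite gram_schmidtE /psd_normalize -[_ *: _]addr0; apply: (WD) => //.
  rewrite /residual addrC -scaleN1r; apply: WD; last exact: residual_null qP _ _ _ _.
  by apply: Wsum => j; apply: IHm; rewrite ltnW.
(* Normalising a non-null residual would give a vector of p-norm 1, so definiteness of p puts s_n in
   the span of the earlier vectors. *)
have rn0 : residual p s n (s n) = 0.
  apply: pdef; apply/eqP; apply: contraTT isT => rn0.
  have := psd_normalizeE pP (residual p s n (s n)).
  by rewrite -gram_schmidtE en0 (psd_0l pP) rn0 => /eqP; rewrite eq_sym oner_eq0.
have Wn : W (s n).
  move/eqP: rn0; rewrite subr_eq0 => /eqP ->.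
  exact: (Wsum n (We n (leqnn n)) (fun i => p (s n) (gram_schmidt p s i))).
by rewrite gram_schmidtE /psd_normalize Wn sqrtC0 invr0 scale0r.
Qed.

(** * Hilbert spaces *)

Section sqnorm_theory.
Variables (R : realType).

Lemma sqnormC (V : normedZmodType R[i]) (x : V) : (sqnorm x)%:C%C = `|x| ^+ 2.
Proof. by rewrite /sqnorm rmorphXn /= RRe_real // ger0_real. Qed.

Lemma sqnorm_ge0 (V : normedZmodType R[i]) (x : V) : 0 <= sqnorm x.
Proof. exact: sqr_ge0. Qed.

Lemma sqnorm0 (V : normedZmodType R[i]) : sqnorm (0 : V) = 0.
Proof. by apply: complexI; rewrite sqnormC normr0 expr0n. Qed.

Lemma sqnormN (V : normedZmodType R[i]) (x : V) : sqnorm (- x) = sqnorm x.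
Proof. by apply: complexI; rewrite !sqnormC normrN. Qed.

Lemma sqnorm_conj (x : R[i]) : sqnorm x^*%R = sqnorm x.
Proof. by apply: complexI; rewrite !sqnormC norm_conjC. Qed.

Lemma sqnormR (x : R) : sqnorm (x%:C%C : R[i]) = x ^+ 2.
Proof.
apply: complexI; rewrite sqnormC real_normK ?rmorphXn //.
by rewrite complex_real.
Qed.

Lemma gtc0_real (e : R[i]) : 0 < e -> exists2 r : R, 0 < r & e = r%:C%C.
Proof.
move=> e0; exists (complex.Re e); last by rewrite RRe_real // gtr0_real.
by rewrite -ltcR RRe_real // gtr0_real.
Qed.

Lemma norm_sqnorm (V : normedZmodType R[i]) (x : V) :
  `|x| = (Num.sqrt (sqnorm x))%:C%C.
Proof.
rewrite /sqnorm sqrtr_sqr ger0_norm ?RRe_real ?ger0_real //.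
by have := normr_ge0 x; rewrite lecE => /andP[].
Qed.

Variable H : hilbertSpace R.
Implicit Types x y z : H.

Lemma inner_sqnorm x : '<x, x> = (sqnorm x)%:C%C.
Proof. by rewrite inner_norm sqnormC. Qed.

Lemma sqnormZ (c : R[i]) x : sqnorm (c *: x) = sqnorm c * sqnorm x.
Proof. by apply: complexI; rewrite sqnormC normrZ exprMn -!sqnormC -rmorphM. Qed.

Lemma psd_inner : psd_form (inner H).
Proof.
split=> [a x y z|x y|x]; last exact: dnorm_ge0.
  exact: linearPl.
by rewrite (hermC (inner H) y x) expr0 mul1r.
Qed.

Lemma inner_CauchySchwarz x y : sqnorm '<x, y> <= sqnorm x * sqnorm y.
Proof.
have := psd_CauchySchwarz psd_inner x y.
by rewrite !inner_sqnorm -sqnormC -rmorphM /= lecR.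
Qed.

End sqnorm_theory.

(** * Continuity of the real power functions on the complex plane *)

Section complex_limits.
Variable R : realType.

Lemma Re_continuous : continuous (@complex.Re R : R[i]^o -> R).
Proof.
move=> z; apply/(@cvgrPdist_lt _ _ _ (nbhs (z : R[i]^o))) => e e0.
have ec : (0 : R[i]) < e%:C%C by rewrite ltcR.
have zz : w @[w --> (z : R[i]^o)] --> (z : R[i]^o) by exact: cvg_id.
near=> w; rewrite -raddfB -ltcR.
apply: (@le_lt_trans _ _ `|z - w|); first exact: normc_ge_Re.
near: w; exact: cvgr_dist_lt _ _ zz _ ec.
Unshelve. all: by end_near.
Qed.

Lemma real_complex_continuous : continuous (fun x : R => x%:C%C : R[i]^o).
Proof.
move=> z; apply/cvgrPdist_lt => e e0.
have [r r0 er] := gtc0_real e0.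
have zz : w @[w --> z] --> z by exact: cvg_id.
near=> w; rewrite er -rmorphB /= normc_def /= expr0n /= addr0 sqrtr_sqr ltcR.
near: w; exact: cvgr_dist_lt _ _ zz _ r0.
Unshelve. all: by end_near.
Qed.

(** Near x > 0 the function is exp(t ln y). At x <= 0 its value is 0, and the radius e^(1/t) keeps
    y^t below e. *)
Lemma powR_pos_continuous (t : R) : 0 < t ->
  continuous (fun x : R => Num.max x 0 `^ t).
Proof.
move=> t0 x.
have [x0|x0] := ltP 0 x.
  have near_pos : \forall y \near x, 0 < y.
    have xx : y @[y --> x] --> x by exact: cvg_id.
    exact: (cvgr_gt x xx 0 x0).
  rewrite /continuous_at (max_l (ltW x0)).
  apply: (@cvg_trans _ (expR (t * ln y) @[y --> x])).
    apply: near_eq_cvg; near=> y.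
    have y0 : 0 < y by near: y.
    by rewrite (max_l (ltW y0)) /powR gt_eqF.
  rewrite /powR gt_eqF //.
  apply: (@continuous_comp _ _ _ (fun y : R => t * ln y) (@expR R)).
    by apply: cvgM; [exact: cvg_cst|exact: continuous_ln].
  exact: continuous_expR.
rewrite /continuous_at (max_r x0) powR0 ?gt_eqF //.
apply/cvgrPdist_lt => e e0.
have d0 : 0 < e `^ t^-1 by exact: powR_gt0.
have xx : y @[y --> x] --> x by exact: cvg_id.
near=> y.
have xy : `|x - y| < e `^ t^-1 by near: y; exact: cvgr_dist_lt _ _ xx _ d0.
rewrite sub0r normrN ger0_norm ?powR_ge0 //.
have [y0|y0] := ltP 0 y; last by rewrite powR0 ?gt_eqF.
have ye : y < e `^ t^-1.
  apply: le_lt_trans xy; rewrite distrC; apply: le_trans (ler_norm _).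
  by rewrite lerBrDr gerDl.
rewrite -[ltRHS]powRr1 ?(ltW e0) // -(mulVf (lt0r_neq0 t0)) powRrM.
by apply: gt0_ltr_powR => //; rewrite nnegrE ?powR_ge0 ?ltW.
Unshelve. all: by end_near.
Qed.

End complex_limits.

(** * Self-adjointness of the powers of an operator *)

Section functional_calculus.
Variables (R : realType) (H : hilbertSpace R).

(* Holds whether or not A has a functional calculus: otherwise A^t is 0. *)
Lemma opow_symmetric (A : {linear H -> H}) (t : R) (x y : H) :
  0 <= t -> '<opow A t x, y> = '<x, opow A t y>.
Proof.
move=> t0; rewrite /opow; case: eqVneq => [//|tn0].
have {}t0 : 0 < t by rewrite lt0r tn0.
rewrite /cfc; case: pselect => [e|_] /=; last first.
  by rewrite (psd_conj (psd_inner H) 0) !(psd_0l (psd_inner H)) conjC0.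
case: (cid e) => Phi PhiP /=.
set f := fun z : R[i] => _.
have fc : cont_spectrum A f.
  apply: continuous_subspaceT => z.
  apply: (@continuous_comp _ _ _ (@complex.Re R : R[i]^o -> R)
            (fun r : R => (Num.max r 0 `^ t)%:C%C : R[i]^o)).
    exact: Re_continuous.
  apply: continuous_comp; first exact: powR_pos_continuous.
  exact: real_complex_continuous.
(* Since [f] is real-valued, it agrees with its conjugate. *)
rewrite (cfc_adjoint PhiP fc); congr ('<_, Phi _ _>).
by apply/funext => z; rewrite /f; apply: CrealP; rewrite complex_real.
Qed.

End functional_calculus.

(** * Series and sums of nonnegative reals *)

Section series.
Variable R : realType.
Implicit Types (a : nat -> R).

Lemma cvg_nonneg_series a K : (forall i, 0 <= a i) ->
  (forall n, \sum_(0 <= i < n) a i <= K) -> cvgn (series a).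
Proof.
move=> a0 aK; apply: nondecreasing_is_cvgn.
  by apply: nondecreasing_series => i _ _; exact: a0.
by exists K => _ [n _ <-]; exact: aK.
Qed.

Lemma esum_series a l : (forall i, 0 <= a i) -> series a @ \oo --> l ->
  (\esum_(i in [set: nat]) (a i)%:E = l%:E)%E.
Proof.
move=> a0 al; rewrite -nneseries_esumT => [|n]; last by rewrite lee_fin.
apply/cvg_lim => //; apply: cvg_EFin; first by near=> n; rewrite sumEFin.
apply: cvg_trans al; apply: near_eq_cvg; near=> n.
by rewrite /= sumEFin.
Unshelve. all: by end_near.
Qed.

Lemma partial_sum_le_esum a K n : (forall i, 0 <= a i) ->
  (\esum_(i in [set: nat]) (a i)%:E <= K%:E)%E -> \sum_(0 <= i < n) a i <= K.
Proof.
move=> a0; rewrite -nneseries_esumT => [|i]; last by rewrite lee_fin.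
move=> h; rewrite -lee_fin -sumEFin; apply: le_trans h.
by apply: nneseries_lim_ge => i _ _; rewrite lee_fin.
Qed.

(** Moves a sum over a countable type to the naturals: numbers that code no index are sent to [o],
    which contributes 0. *)
Lemma esum_unpickle (I : countType) (T : Type) (F : T -> \bar R) (f : I -> T)
    (o : T) : F o = 0%E ->
  (\esum_(i in [set: I]) F (f i) =
   \esum_(n in [set: nat]) F (oapp f o (pickle_inv n)))%E.
Proof.
move=> Fo; transitivity (\esum_(n in range (@pickle I))
    F (oapp f o (pickle_inv n)))%E.
  rewrite (reindex_esum [set: I] _ pickle).
    by apply: eq_esum => i _; rewrite pickleK_inv.
  split=> // i j _ _; exact: (pcan_inj pickleK_inv).
rewrite esum_mkcond; apply: eq_esum => n _; case: ifPn => // nI.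
case En: (pickle_inv n) => [i|] /=; last by rewrite Fo.
case/negP: nI; rewrite inE; exists i => //.
by have := @pickle_invK I n; rewrite En.
Qed.

End series.

(** * Bessel sequences and their synthesis operators *)

Section bessel.
Variables (R : realType).

(** Trades the complex-valued radii of the norm topology for real ones. *)
Lemma cvg_sqnormP (V : normedModType R[i]) (u : nat -> V) (x : V) :
  (forall e : R, 0 < e -> \forall n \near \oo, sqnorm (u n - x) < e) <->
  u @ \oo --> x.
Proof.
split=> [h|ux e e0].
  apply/cvgrPdist_lt => e e0.
  have [r r0 er] := gtc0_real e0.
  near=> n.
  have : sqnorm (u n - x) < r ^+ 2 by near: n; exact: h _ (exprn_gt0 2 r0).
  rewrite distrC norm_sqnorm er ltcR => hn.
  by rewrite -(ger0_norm (ltW r0)) -sqrtr_sqr ltr_sqrt // exprn_gt0.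
have e1 : (0 : R[i]) < (Num.sqrt e)%:C%C by rewrite ltcR sqrtr_gt0.
near=> n.
have : `|x - u n| < (Num.sqrt e)%:C%C by near: n; exact: cvgr_dist_lt _ _ ux _ e1.
by rewrite distrC norm_sqnorm ltcR ltr_sqrt.
Unshelve. all: by end_near.
Qed.

Lemma cvg_sqnorm (V : normedModType R[i]) (u : nat -> V) (x : V) :
  u @ \oo --> x -> (fun n => sqnorm (u n)) @ \oo --> sqnorm x.
Proof.
move=> ux.
apply: (@cvgM _ _ _ _ (fun n => complex.Re `|u n|) (fun n => complex.Re `|u n|)).
  by apply: (cvg_comp _ _ (cvg_norm ux)); exact: Re_continuous.
by apply: (cvg_comp _ _ (cvg_norm ux)); exact: Re_continuous.
Qed.

Variable H : hilbertSpace R.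
Implicit Types (x y : H) (g h : nat -> H) (c : nat -> R[i]).

Lemma cvg_innerl (u : nat -> H) x y :
  u @ \oo --> x -> (fun n => '<u n, y> : R[i]^o) @ \oo --> ('<x, y> : R[i]^o).
Proof.
move=> /cvg_sqnormP ux; apply/cvg_sqnormP => e e0.
have y0 : 0 < sqnorm y + 1 by rewrite ltr_wpDl ?sqnorm_ge0.
near=> n.
have : sqnorm (u n - x) < e / (sqnorm y + 1).
  by near: n; exact: ux (divr_gt0 e0 y0).
rewrite ltr_pdivlMr // => h.
rewrite -(psd_subl (psd_inner H)).
apply: le_lt_trans (inner_CauchySchwarz _ _) _; apply: le_lt_trans h.
by rewrite ler_wpM2l ?sqnorm_ge0 // lerDl.
Unshelve. all: by end_near.
Qed.

Definition bessel_seq b g :=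
  forall x n, \sum_(0 <= i < n) sqnorm '<x, g i> <= b * sqnorm x.

Lemma Re_mul_le (b : R) (c d : R[i]) : 0 <= b ->
  (b * complex.Re (c * d)) *+ 2 <= b ^+ 2 * sqnorm c + sqnorm d.
Proof.
move=> b0.
have h : complex.Re (c * d) <= Num.sqrt (sqnorm c) * Num.sqrt (sqnorm d).
  apply: le_trans (ler_norm _) _; rewrite -lecR rmorphM /= -!norm_sqnorm -normrM.
  exact: normc_ge_Re.
have := sqr_ge0 (b * Num.sqrt (sqnorm c) - Num.sqrt (sqnorm d)).
rewrite sqrrB exprMn !sqr_sqrtr ?sqnorm_ge0 // addrAC subr_ge0.
by apply: le_trans; rewrite lerMn2r /= -mulrA ler_wpM2l.
Qed.

(** For v = sum c_i g_i one has |v|^2 = sum Re(c_i <g_i, v>). The weighted inequality [Re_mul_le]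
    and the Bessel bound at v give 2b|v|^2 <= b^2 sum |c_i|^2 + b|v|^2; then cancel b|v|^2 and
    divide by b. *)
Lemma sqnorm_synthesis b g c m n : 0 < b -> bessel_seq b g ->
  sqnorm (\sum_(m <= i < n) c i *: g i) <=
  b * \sum_(m <= i < n) sqnorm (c i).
Proof.
move=> b0 gb; set v := \sum_(m <= i < n) _.
have vE : sqnorm v = \sum_(m <= i < n) complex.Re (c i * '<g i, v>).
  have -> : sqnorm v = complex.Re '<v, v> by rewrite inner_sqnorm.
  rewrite {1}/v (psd_suml (psd_inner H)) raddf_sum; apply: eq_bigr => i _.
  by rewrite (psd_scalel (psd_inner H)).
have hg : \sum_(m <= i < n) sqnorm '<v, g i> <= b * sqnorm v.
  apply: le_trans (gb v n); have [mn|mn] := leqP m n; last first.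
    by rewrite big_geq ?(ltnW mn) // sumr_ge0 // => i _; rewrite sqnorm_ge0.
  rewrite [leRHS](big_cat_nat (leq0n m) mn) //= lerDr.
  by rewrite sumr_ge0 // => i _; rewrite sqnorm_ge0.
have : (b * sqnorm v) *+ 2 <=
    b ^+ 2 * (\sum_(m <= i < n) sqnorm (c i)) + b * sqnorm v.
  apply: le_trans (lerD (lexx _) hg).
  rewrite {1}vE !mulr_sumr -sumrMnl -big_split /=; apply: ler_sum => i _.
  rewrite (psd_conj (psd_inner H) (g i) v) sqnorm_conj; exact: Re_mul_le (ltW b0).
by rewrite mulr2n lerD2r expr2 -mulrA ler_pM2l.
Qed.

Lemma synthesis_cvg b g c : 0 < b -> bessel_seq b g ->
  cvgn (series (fun i => sqnorm (c i))) ->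
  cvgn (series (fun i => c i *: g i)).
Proof.
move=> b0 gb /cvg_cauchy /cauchy_seriesP hc.
apply: cauchy_cvg; apply/cauchy_seriesP => e e0.
have [r r0 er] := gtc0_real e0.
have := hc (r ^+ 2 / b) (divr_gt0 (exprn_gt0 2 r0) b0).
apply: filterS => -[m n] /= hmn.
rewrite norm_sqnorm er ltcR -(ger0_norm (ltW r0)) -sqrtr_sqr.
rewrite ltr_sqrt ?exprn_gt0 //.
apply: le_lt_trans (sqnorm_synthesis _ _ _ b0 gb) _.
rewrite mulrC -ltr_pdivlMr //; apply: le_lt_trans hmn; exact: ler_norm.
Qed.

Lemma bessel_cvg_sqnorm b g x : bessel_seq b g ->
  cvgn (series (fun i => sqnorm '<x, g i>)).
Proof.
by move=> gb; apply: cvg_nonneg_series (gb x) => i; exact: sqnorm_ge0.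
Qed.

(** Serves twice: with coefficients <x, f_i> it yields the frame operator, and with q(x, u_i) the
    factor of a form q. *)
Lemma synthesis_operator b h (phi : nat -> H -> R[i]) :
  0 < b -> bessel_seq b h ->
  (forall i a x y, phi i (a *: x + y) = a * phi i x + phi i y) ->
  (forall x, cvgn (series (fun i => sqnorm (phi i x)))) ->
  exists S : {linear H -> H},
    forall x, series (fun i => phi i x *: h i) @ \oo --> S x.
Proof.
move=> b0 hb phiL phic.
have hc x := synthesis_cvg b0 hb (phic x).
pose S x : H := limn (series (fun i => phi i x *: h i)).
have Sl : linear S.
  move=> a x y; apply/cvg_lim => //.
  suff -> : series (fun i => phi i (a *: x + y) *: h i) =
      fun n => a *: series (fun i => phi i x *: h i) n +
               series (fun i => phi i y *: h i) n.
    exact: cvgD (cvgZ (@cvg_cst _ (a : R[i]^o) _ _ _) (hc x)) (hc y).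
  apply/funext => n; rewrite /series /= scaler_sumr -big_split /=.
  by apply: eq_bigr => i _; rewrite phiL scalerDl scalerA.
pose Sm := GRing.isLinear.Build _ _ _ _ S Sl.
pose SL : {linear H -> H} := HB.pack S Sm.
by exists SL => x; exact: hc.
Qed.

End bessel.

(** * Dense sequences and bounded operators *)

Section limits_in_hilbert.
Variables (R : realType) (H : hilbertSpace R).

Lemma cvg_conj (u : nat -> R[i]) (z : R[i]) :
  (u : nat -> R[i]^o) @ \oo --> (z : R[i]^o) ->
  (fun n => (u n)^*%R : R[i]^o) @ \oo --> (z^*%R : R[i]^o).
Proof.
move=> /cvg_sqnormP uz; apply/cvg_sqnormP => e e0; near=> n.
rewrite -rmorphB sqnorm_conj; near: n; exact: uz.
Unshelve. all: by end_near.
Qed.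

Lemma cvg_complex_unique (u : nat -> R[i]) (y z : R[i]) :
  (u : nat -> R[i]^o) @ \oo --> (y : R[i]^o) ->
  (u : nat -> R[i]^o) @ \oo --> (z : R[i]^o) -> y = z.
Proof. by move=> uy uz; exact: (cvg_unique _ uy uz). Qed.

Definition dense_seq (s : nat -> H) :=
  forall x (e : R), 0 < e -> exists n, sqnorm (x - s n) < e.

Lemma separable_dense_seq : separable_space H -> exists s, dense_seq s.
Proof.
move=> [D [/countable_injP[f fI] Dd]].
(* The term s_n is the point of D coded by n, or 0 if there is none; the extra zeros do not affect
   density. *)
pose s n := xget (0 : H) [set x | D x /\ f x = n].
exists s => x e e0.
have r0 : (0 : R[i]) < (Num.sqrt e)%:C%C by rewrite ltcR sqrtr_gt0.
have [|y [yx Dy]] := Dd (ball x (Num.sqrt e)%:C%C)^°%classic _ (open_interior _).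
  by exists x; exact: nbhsx_ballx.
exists (f y).
have -> : s (f y) = y.
  rewrite /s; case: xgetP => [z _ [Dz fz]|/(_ y)]; last by case.
  by apply: fI => //; rewrite inE.
have := interior_subset yx; rewrite -ball_normE /ball_ /= norm_sqnorm ltcR.
by rewrite ltr_sqrt.
Qed.

Lemma bounded_continuous (V W : normedModType R[i]) (C : {linear V -> W}) (b : R) :
  0 < b -> (forall x, sqnorm (C x) <= b * sqnorm x) -> continuous C.
Proof.
move=> b0 Cb; apply: bounded_linear_continuous; apply/linear_boundedP.
near=> r => x.
apply: (@le_trans _ _ ((Num.sqrt b)%:C%C * `|x|)).
  rewrite !norm_sqnorm -rmorphM lecR -sqrtrM ?(ltW b0) //.
  by rewrite ler_sqrt ?Cb // mulr_ge0 ?sqnorm_ge0 ?ltW.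
rewrite ler_wpM2r //; near: r; apply: nbhs_pinfty_ge.
by rewrite complex_real.
Unshelve. all: by end_near.
Qed.

Lemma continuous_bounded (V W : normedModType R[i]) (C : {linear V -> W}) :
  continuous C -> exists2 b : R, 0 < b & forall x, sqnorm (C x) <= b * sqnorm x.
Proof.
move=> Cc.
have /linear_boundedP [M [Mr CM]] := continuous_linear_bounded 0 (Cc 0).
have M1 : M < M + 1 by rewrite ltrDl.
have r1 : M + 1 \is Num.real by rewrite realD.
(* Any constant strictly above M bounds C, whence M + 1; the final 1 makes the result positive. *)
exists (complex.Re (M + 1) ^+ 2 + 1) => [|x].
  by rewrite ltr_wpDl ?sqr_ge0.
apply: (@le_trans _ _ (complex.Re (M + 1) ^+ 2 * sqnorm x)); last first.
  by rewrite ler_wpM2r ?sqnorm_ge0 // lerDl.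
have rE : (complex.Re (M + 1) ^+ 2 * sqnorm x)%:C%C = ((M + 1) * `|x|) ^+ 2.
  by rewrite rmorphM rmorphXn /= RRe_real // sqnormC -exprMn.
rewrite -lecR rE sqnormC.
have h := CM _ M1 x.
by rewrite ler_pXn2r // nnegrE // (le_trans _ h).
Qed.

Lemma psd_real (q : H -> H -> R[i]) x : psd_form q ->
  q x x = (complex.Re (q x x))%:C%C.
Proof. by move=> qP; rewrite RRe_real // ger0_real // (psd_ge0 qP). Qed.

End limits_in_hilbert.

(** * Parseval's identity for bounded semidefinite forms *)

Section parseval.
Variables (R : realType) (H : hilbertSpace R) (s : nat -> H).
Hypothesis sD : dense_seq s.
Variables (q : H -> H -> R[i]) (b : R).
Hypotheses (qP : psd_form q) (b0 : 0 < b).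
Hypothesis qb : forall x, complex.Re (q x x) <= b * sqnorm x.
Local Notation u := (gram_schmidt q s).

Lemma Re_residual n x :
  complex.Re (q (residual q s n x) (residual q s n x)) =
  complex.Re (q x x) - \sum_(0 <= i < n) sqnorm (q x (u i)).
Proof.
rewrite (residual_norm qP) raddfB /= raddf_sum big_mkord; congr (_ - _).
by apply: eq_bigr => i _; rewrite -sqnormC.
Qed.

(** Boundedness of q turns density of s in norm into density for q: if |x - s_m|^2 < e / b, every
    residual after stage m is below e. Hence one sequence serves all bounded forms. *)
Lemma Re_residual_lt x e : 0 < e -> \forall n \near \oo,
  complex.Re (q (residual q s n x) (residual q s n x)) < e.
Proof.
move=> e0; have [m xm] := sD x (divr_gt0 e0 b0).
near=> n; rewrite -ltcR -(psd_real _ qP).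
have mn : (m < n)%N by near: n; exact: nbhs_infty_gt.
apply: le_lt_trans (residual_le qP _ _ mn) _.
rewrite (psd_real _ qP) ltcR; apply: le_lt_trans (qb _) _.
by rewrite mulrC -ltr_pdivlMr.
Unshelve. all: by end_near.
Qed.

Lemma gram_schmidt_bessel x n :
  \sum_(0 <= i < n) sqnorm (q x (u i)) <= complex.Re (q x x).
Proof.
by rewrite -subr_ge0 -Re_residual -ler0c -(psd_real _ qP) (psd_ge0 qP).
Qed.

Lemma gram_schmidt_parseval x :
  series (fun i => sqnorm (q x (u i))) @ \oo --> complex.Re (q x x).
Proof.
apply/cvgrPdist_lt => e e0; near=> n.
rewrite ger0_norm ?subr_ge0 ?gram_schmidt_bessel // -Re_residual.
by near: n; exact: Re_residual_lt.
Unshelve. all: by end_near.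
Qed.

End parseval.

(** * Orthonormal expansions, factorisation of forms, adjoints *)

Section orthonormal.
Variables (R : realType) (H : hilbertSpace R) (s : nat -> H).
Hypothesis sD : dense_seq s.
Local Notation e := (gram_schmidt (inner H) s).

Let Re_inner (x : H) : complex.Re '<x, x> = sqnorm x.
Proof. by rewrite inner_sqnorm. Qed.

Let Re_inner_le (x : H) : complex.Re '<x, x> <= 1 * sqnorm x.
Proof. by rewrite Re_inner mul1r. Qed.

Lemma orthonormal_bessel : bessel_seq 1 e.
Proof.
move=> x n; rewrite mul1r -Re_inner.
by have := gram_schmidt_bessel s (psd_inner H) x n.
Qed.

Lemma parseval x : series (fun i => sqnorm '<x, e i>) @ \oo --> sqnorm x.
Proof.
rewrite -Re_inner.
exact: (gram_schmidt_parseval sD (psd_inner H) ltr01 Re_inner_le).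
Qed.

Lemma orthonormal_expansion x : series (fun i => '<x, e i> *: e i) @ \oo --> x.
Proof.
apply/cvg_sqnormP => r r0; near=> n.
rewrite -sqnormN opprB -Re_inner.
rewrite (_ : x - _ = residual (inner H) s n x); last first.
  by rewrite /residual /series /= big_mkord.
near: n; exact: (Re_residual_lt sD (psd_inner H) ltr01 Re_inner_le).
Unshelve. all: by end_near.
Qed.

(** The factor [sqnorm (e i)] is 1 or 0; it accounts for the zero vectors among the e_i. *)
Lemma sqnorm_orthonormal_sum (c : nat -> R[i]) n :
  sqnorm (\sum_(0 <= i < n) c i *: e i) =
  \sum_(0 <= i < n) sqnorm (c i) * sqnorm (e i).
Proof.
elim: n => [|n IHn]; first by rewrite !big_geq // sqnorm0.
rewrite !big_nat_recr //= -IHn -sqnormZ.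
have o : '<\sum_(0 <= i < n) c i *: e i, c n *: e n> = 0.
  rewrite (psd_scaler (psd_inner H)) (psd_suml (psd_inner H)) big_nat.
  rewrite big1 ?mulr0 // => i /andP[_ ni]; rewrite (psd_scalel (psd_inner H)).
  by rewrite (gram_schmidt_orthogonal (psd_inner H)) ?mulr0 // neq_ltn ni.
by apply: complexI; rewrite rmorphD /= -!inner_sqnorm (hnormDd o).
Qed.

Lemma sqnorm_orthonormal i : sqnorm (e i) = (e i != 0)%:R.
Proof.
apply: complexI; rewrite -inner_sqnorm (gram_schmidt_norm (psd_inner H)).
by rewrite dnorm_eq0 rmorph_nat.
Qed.

(* A Cholesky factorisation: C has a triangular matrix in the orthonormal
   basis obtained from s. *)
Lemma psd_factorization (q : H -> H -> R[i]) (b : R) : psd_form q -> 0 < b ->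
  (forall x, complex.Re (q x x) <= b * sqnorm x) ->
  exists2 C : {linear H -> H},
    continuous C & forall x, sqnorm (C x) = complex.Re (q x x).
Proof.
move=> qP b0 qb; pose u := gram_schmidt q s.
have qu := gram_schmidt_parseval sD qP b0 qb.
have [C CE] := synthesis_operator (phi := fun i x => q x (u i)) ltr01
  orthonormal_bessel (fun i a x y => psd_linear qP a x y (u i))
  (fun x => cvgP _ (qu x)).
have CqE x : sqnorm (C x) = complex.Re (q x x).
  apply: (cvg_unique _ (cvg_sqnorm (CE x))) => //.
  apply: cvg_trans (qu x); apply: near_eq_cvg; near=> n.
  rewrite /series /= sqnorm_orthonormal_sum; apply: eq_bigr => i _.
  (* Where e_i = 0 the term |q(x, u_i)|^2 drops out of |C x|^2; nothing is lost, because then u_i =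
     0. *)
  rewrite sqnorm_orthonormal; case: eqVneq => [ei0|]; last by rewrite mulr1.
  rewrite (_ : gram_schmidt q s i = 0) ?mulr0.
    by rewrite -[0](scale0r 0) (psd_scaler qP) conjC0 mul0r sqnorm0.
  apply: (gram_schmidt_eq0 (psd_inner H)) ei0 => // x0 /eqP.
  by rewrite dnorm_eq0 => /eqP.
exists C => //; apply: (bounded_continuous b0) => x.
by rewrite CqE.
Unshelve. all: by end_near.
Qed.

(** f is C^* y, built as sum c_i e_i with c_i the conjugate of <C e_i, y>. For square summability,
    test C on the partial sum g: with r = sum |c_i|^2 one gets r = <C g, y>, so r^2 <= K r |y|^2. *)
Lemma riesz_adjoint (Y : hilbertSpace R) (C : {linear H -> Y}) (y : Y) :
  continuous C -> exists f, forall x, '<x, f> = '<C x, y>.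
Proof.
move=> Cc; have [K K0 CK] := continuous_bounded Cc.
pose c i := ('<C (e i), y>)^*%R.
have cK n : \sum_(0 <= i < n) sqnorm (c i) <= K * sqnorm y.
  set r := (X in X <= _); set g := \sum_(0 <= i < n) c i *: e i.
  have r_ge0 : 0 <= r by apply: sumr_ge0 => i _; exact: sqnorm_ge0.
  have gE : '<C g, y> = r%:C%C.
    rewrite linear_sum (psd_suml (psd_inner Y)) /r rmorph_sum /=.
    apply: eq_bigr => i _; rewrite linearZ (psd_scalel (psd_inner Y)).
    by rewrite sqnormC /c norm_conjC normCKC.
  have gr : sqnorm g <= r.
    by have := sqnorm_synthesis c 0 n ltr01 orthonormal_bessel; rewrite mul1r.
  have [->|rn0] := eqVneq r 0; first by rewrite mulr_ge0 ?sqnorm_ge0 ?ltW.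
  have r0 : 0 < r by rewrite lt0r rn0.
  rewrite -(ler_pM2r r0) -expr2 -sqnormR -gE mulrAC.
  apply: le_trans (inner_CauchySchwarz _ _) _; rewrite ler_wpM2r ?sqnorm_ge0 //.
  by apply: le_trans (CK _) _; rewrite ler_wpM2l // ltW.
have /(synthesis_cvg ltr01 orthonormal_bessel) gc :=
  cvg_nonneg_series (fun i => sqnorm_ge0 (c i)) cK.
exists (limn (series (fun i => c i *: e i))) => x; set f := limn _.
rewrite (psd_conj (psd_inner H) f x).
apply: (canLR conjCK).
(* Both sides are limits of sum c_i <e_i, x>: the left by definition of f, the right by expanding x
   and using continuity of C. *)
apply: (cvg_complex_unique (cvg_innerl (y := x) gc)).
have Cx := cvg_comp _ _ (orthonormal_expansion (x := x)) (Cc x).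
have := cvg_conj (cvg_innerl (y := y) Cx).
apply: cvg_trans; apply: near_eq_cvg; near=> n.
rewrite /series /= linear_sum !(psd_suml (psd_inner _)) rmorph_sum.
apply: eq_bigr => i _; rewrite linearZ (psd_scalel (psd_inner Y)) rmorphM /=.
rewrite (psd_scalel (psd_inner H) (c i)).
by rewrite -(psd_conj (psd_inner H) x (e i)) mulrC.
Unshelve. all: by end_near.
Qed.

End orthonormal.

(** * From Bessel sequences to bounded operators *)

Section frame_form.
Variables (R : realType) (H : hilbertSpace R).

(** The form is written as <S x, y> with S the frame operator, so linearity comes for free;
    symmetry, positivity and the bound b pass to the limit from partial sums. *)
Lemma bessel_factorization (b : R) (f : nat -> H) :
  separable_space H -> 0 < b -> bessel_seq b f ->
  exists2 C : {linear H -> H}, continuous C &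
    forall x, series (fun i => sqnorm '<x, f i>) @ \oo --> sqnorm (C x).
Proof.
move=> /separable_dense_seq[s sD] b0 fb.
have fc x : cvgn (series (fun i => sqnorm '<x, f i>)) :=
  bessel_cvg_sqnorm (x := x) fb.
have [S SE] := synthesis_operator (phi := fun i x => '<x, f i>) b0 fb
  (fun i a x y => psd_linear (psd_inner H) a x y (f i)) fc.
have SfE x y : (fun n => \sum_(0 <= i < n) '<x, f i> * '<f i, y> : R[i]^o) @ \oo
    --> ('<S x, y> : R[i]^o).
  apply: cvg_trans (cvg_innerl (y := y) (SE x)); apply: near_eq_cvg; near=> n.
  rewrite /series /= (psd_suml (psd_inner H)); apply: eq_bigr => i _.
  by rewrite (psd_scalel (psd_inner H)).
have SxE x : '<S x, x> = (limn (series (fun i => sqnorm '<x, f i>)))%:C%C.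
  apply: (cvg_complex_unique (SfE x x)).
  have := cvg_comp _ _ (fc x) (@real_complex_continuous R _).
  apply: cvg_trans; apply: near_eq_cvg; near=> n.
  rewrite /series /= rmorph_sum /=; apply: eq_bigr => i _.
  by rewrite sqnormC (psd_conj (psd_inner H) x (f i)) normCK.
have qP : psd_form (fun x y => '<S x, y>).
  split=> [a x y z|x y|x].
  - by rewrite linearP (psd_linear (psd_inner H)).
  - apply: (cvg_complex_unique (SfE y x)).
    apply: cvg_trans (cvg_conj (SfE x y)); apply: near_eq_cvg; near=> n.
    rewrite rmorph_sum; apply: eq_bigr => i _; rewrite rmorphM /=.
    by rewrite -!(psd_conj (psd_inner H)) mulrC.
  - rewrite SxE ler0c; apply: limr_ge => //; near=> n.
    by apply: sumr_ge0 => i _; exact: sqnorm_ge0.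
have qb x : complex.Re '<S x, x> <= b * sqnorm x.
  by rewrite SxE; apply: limr_le => //; near=> n; exact: fb.
have [C Cc CE] := psd_factorization sD qP b0 qb.
by exists C => // x; rewrite CE SxE; exact: fc.
Unshelve. all: by end_near.
Qed.

End frame_form.

(** * Translation between orbit frames and exact observability *)

Section frames_and_observability.
Variables (R : realType) (H : hilbertSpace R) (A : {linear H -> H}).

(** Self-adjointness gives <x, A^t f_i> = <A^t x, f_i>, so summing over i yields |C A^t x|^2 and the
    two frame inequalities coincide. *)
Lemma orbit_frame_observable (Y : hilbertSpace R) (C : {linear H -> Y})
    (T : set R) (I : countType) (f : I -> H) :
  (forall t, T t -> 0 <= t) ->
  (forall x, (\esum_(i in [set: I]) (sqnorm '<x, f i>)%:E =
              (sqnorm (C x))%:E)%E) ->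
  orbit_frame T A f <-> exactly_observable T A C.
Proof.
move=> T0 fC.
have E x : (\esum_(t in T) \esum_(i in [set: I]) (sqnorm '<x, opow A t (f i)>)%:E =
            \esum_(t in T) (sqnorm (C (opow A t x)))%:E)%E.
  apply: eq_esum => t /T0 t0; rewrite -fC; apply: eq_esum => i _.
  by rewrite opow_symmetric.
by split=> -[a [b [a0 ab h]]]; exists a, b; split=> // x; move: (h x); rewrite E.
Qed.

(** The time 0 alone, where A^0 = I, contributes at most the whole sum. *)
Lemma orbit_frame_bessel (I : countType) (f : I -> H) :
  orbit_frame (@Ntimes R) A f -> exists2 b : R, 0 < b &
    forall x, (\esum_(i in [set: I]) (sqnorm '<x, f i>)%:E <=
               (b * sqnorm x)%:E)%E.
Proof.
move=> [a [b [a0 ab h]]]; exists b => [|x]; first exact: lt_le_trans ab.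
have /andP[_] := h x; apply: le_trans; apply: esum_ge.
exists [set 0 : R].
  by split; [exact: finite_set1|move=> _ ->; exists 0%N].
by rewrite fsbig_set1 /opow eqxx.
Qed.

Lemma orbit_frame_factorization (I : countType) (f : I -> H) :
  separable_space H -> orbit_frame (@Ntimes R) A f ->
  exists2 C : {linear H -> H}, continuous C &
    forall x, (\esum_(i in [set: I]) (sqnorm '<x, f i>)%:E =
               (sqnorm (C x))%:E)%E.
Proof.
move=> Hsep /orbit_frame_bessel[b b0 fb].
pose g n := oapp f 0 (pickle_inv n).
have fg x : (\esum_(i in [set: I]) (sqnorm '<x, f i>)%:E =
             \esum_(n in [set: nat]) (sqnorm '<x, g n>)%:E)%E.
  rewrite (@esum_unpickle _ _ _ (fun y => (sqnorm '<x, y>)%:E) f 0) //.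
  by rewrite linear0r sqnorm0.
have gb : bessel_seq b g.
  move=> x n; apply: partial_sum_le_esum => [i|]; first exact: sqnorm_ge0.
  by rewrite -fg.
have [C Cc CE] := bessel_factorization Hsep b0 gb.
exists C => // x; rewrite fg; apply: esum_series (CE x) => i.
exact: sqnorm_ge0.
Qed.

(** With f_i = C^* e_i for the orthonormal vectors e_i of Y, the sum is Parseval's identity for C
    x. *)
Lemma adjoint_orthonormal (Y : hilbertSpace R) (C : {linear H -> Y}) :
  separable_space H -> separable_space Y -> continuous C ->
  exists f : nat -> H,
    forall x, (\esum_(i in [set: nat]) (sqnorm '<x, f i>)%:E =
               (sqnorm (C x))%:E)%E.
Proof.
move=> /separable_dense_seq[s sD] /separable_dense_seq[r rD] Cc.
have /choice[f fE] i := riesz_adjoint sD (gram_schmidt (inner Y) r i) Cc.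
exists f => x; apply: esum_series => [i|]; first exact: sqnorm_ge0.
under [fun i => sqnorm _]eq_fun do rewrite fE.
exact: parseval.
Qed.

End frames_and_observability.

Theorem theorem6p1 (R : realType) (T : set R) (hT : locally_finite_times T) :
  universal_times T <->
  (forall H : hilbertSpace R, separable_space H ->
   forall A : {linear H -> H}, positive_op A ->
   forall (I : countType) (f : I -> H),
     orbit_frame (@Ntimes R) A f -> orbit_frame T A f).
Proof.
have T0 := hT.1.
have N0 (t : R) : @Ntimes R t -> 0 <= t by move=> [n _ <-].
split=> [[_ Tuniv] H Hsep A Apos I f fN|Tframe].
  (* C depends only on f, so the same C, with Y = H, serves the time sets of both hypothesis and
     conclusion. *)
  have [C Cc fC] := orbit_frame_factorization Hsep fN.
  apply/(orbit_frame_observable A T0 fC); apply: Tuniv => //.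
  exact/(orbit_frame_observable A N0 fC).
split=> // H Y Hsep Ysep A C Apos Cc CN.
have [f fC] := adjoint_orthonormal Hsep Ysep Cc.
apply/(orbit_frame_observable A T0 fC); apply: Tframe => //.
exact/(orbit_frame_observable A N0 fC).
Qed.
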